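(* Let $\mathfrak{B}$ be a bornology on a metric space $X$ with a closed base and let $X$ be $\mathfrak{B}^s$-Lindelöf. Let the ideal $\mathcal{J}$ on $\omega$ have a pseudounion. The following statements are equivalent. (1) $X$ satisfies $\mathrm{S}_1(\mathcal{O}_{\mathfrak{B}^s},\mathcal{J}\text{-}\Gamma_{\mathfrak{B}^s})$. (2) $X$ satisfies $\mathrm{S}_1(\mathcal{O}_{\mathfrak{B}^s},\Gamma_{\mathfrak{B}^s})$.
   Context: $(X,d)$ is an infinite metric space; $\omega$ is the set of natural numbers. A bornology $\mathfrak{B}$ on $X$ is a family of subsets of $X$ that is closed under subsets and finite unions and covers $X$. A base of $\mathfrak{B}$ is a subfamily $\mathfrak{B}_0\subseteq\mathfrak{B}$ such that every $B\in\mathfrak{B}$ is contained in some $B_0\in\mathfrak{B}_0$; it is a closed base if its members are closed. For $B\in\mathfrak{B}$, $\delta>0$: $B^\delta=\bigcup_{x\in B}\{y\in X:d(x,y)<\delta\}$. An ideal on $\omega$ is a family $\mathcal{J}\subseteq\mathcal{P}(\omega)$ closed under subsets and finite unions, containing all finite sets, with $\omega\notin\mathcal{J}$. A set $A\subseteq\omega$ is a pseudounion of $\mathcal{J}$ if $\omega\setminus A$ is infinite and $I\setminus A$ is finite for every $I\in\mathcal{J}$. Covers of $X$ never contain $X$ as an element. A cover $\mathcal{U}$ of $X$ is a $\mathfrak{B}^s$-cover if for each $B\in\mathfrak{B}$ there are $U\in\mathcal{U}$ and $\delta>0$ with $B^\delta\subseteq U$; it is an open $\mathfrak{B}^s$-cover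 if its members are open. $\mathcal{O}_{\mathfrak{B}^s}$ is the class of open $\mathfrak{B}^s$-covers of $X$. $X$ is $\mathfrak{B}^s$-Lindelöf if every $\mathfrak{B}^s$-cover of $X$ contains a countable subset which is a $\mathfrak{B}^s$-cover of $X$. An open cover $\{U_n:n\in\omega\}$ (with its enumeration) is a $\gamma_{\mathfrak{B}^s}$-cover if it is infinite and for each $B\in\mathfrak{B}$ there are $n_0\in\omega$ and positive reals $\delta_n$ ($n\geq n_0$) with $B^{\delta_n}\subseteq U_n$ for all $n\geq n_0$; $\Gamma_{\mathfrak{B}^s}$ is the class of these. A countable open cover $\{U_n:n\in\omega\}$ (with its enumeration) is a $\mathcal{J}$-$\gamma_{\mathfrak{B}^s}$-cover if for each $B\in\mathfrak{B}$ there is a sequence $\{\delta_n\}$ of positive reals with $\{n\in\omega:B^{\delta_n}\nsubseteq U_n\}\in\mathcal{J}$; $\mathcal{J}\text{-}\Gamma_{\mathfrak{B}^s}$ is the class of these. $\mathrm{S}_1(\mathcal{A},\mathcal{B})$: for every sequence $\{A_n:n\in\omega\}$ of elements of $\mathcal{A}$ there are $a_n\in A_n$ ($n\in\omega$) such that $\{a_n:n\in\omega\}\in\mathcal{B}$ (for enumerated covers, with the enumeration $n\mapsto a_n$). *)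

(* Defs.v *)
From mathcomp Require Import all_boot all_order all_algebra.
From mathcomp Require Import all_classical all_reals all_analysis.

Set Implicit Arguments.
Unset Strict Implicit.
Unset Printing Implicit Defensive.

Import Order.TTheory GRing.Theory Num.Theory.

Local Open Scope classical_set_scope.
Local Open Scope ring_scope.

Definition omega_ideal (J : set (set nat)) : Prop :=
  [/\ forall A B : set nat, A `<=` B -> J B -> J A,
      forall A B : set nat, J A -> J B -> J (A `|` B),
      forall A : set nat, finite_set A -> J A
    & ~ J [set: nat]].

Definition pseudounion (J : set (set nat)) (A : set nat) : Prop :=
  infinite_set (~` A) /\ forall I : set nat, J I -> finite_set (I `\` A).

(* The covers in the target class are enumerated, so that class consists of
   sequences of sets rather than of families of sets. *)
Definition S1 (X : Type) (A : set (set (set X))) (B : set (nat -> set X)) : Prop :=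
  forall u : nat -> set (set X), (forall n, A (u n)) ->
    exists a : nat -> set X, (forall n, u n (a n)) /\ B a.

(* Covers never contain the whole space as an element. *)
Definition is_cover (X : Type) (U : set (set X)) : Prop :=
  \bigcup_(V in U) V = [set: X] /\ ~ U [set: X].

Definition bornology (X : Type) (BB : set (set X)) : Prop :=
  [/\ forall A B : set X, A `<=` B -> BB B -> BB A,
      forall A B : set X, BB A -> BB B -> BB (A `|` B)
    & \bigcup_(B in BB) B = [set: X]].

Definition bornology_base (X : Type) (BB B0 : set (set X)) : Prop :=
  B0 `<=` BB /\ forall B, BB B -> exists2 C, B0 C & B `<=` C.

Section Covers.
Context {R : realType} {X : metricType R}.
Implicit Types (B : set X) (BB : set (set X)) (U : set (set X)).

Definition closed_base BB (B0 : set (set X)) : Prop :=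
  bornology_base BB B0 /\ forall B, B0 B -> closed B.

Definition enlarge B (delta : R) : set X :=
  \bigcup_(x in B) [set y | mdist x y < delta].

Definition Bs_cover BB U : Prop :=
  is_cover U /\
  forall B, BB B -> exists2 V, U V & exists2 delta : R, 0 < delta & enlarge B delta `<=` V.

Definition open_Bs_cover BB : set (set (set X)) :=
  [set U | Bs_cover BB U /\ forall V, U V -> open V].

Definition Bs_Lindelof BB : Prop :=
  forall U, Bs_cover BB U ->
    exists V : set (set X), [/\ V `<=` U, countable V & Bs_cover BB V].

Definition gamma_Bs_cover BB : set (nat -> set X) :=
  [set U | [/\ is_cover (range U), forall n, open (U n),
               infinite_set (range U)
             & forall B, BB B -> exists (n0 : nat) (delta : nat -> R),
                 forall n, (n0 <= n)%N ->
                   0 < delta n /\ enlarge B (delta n) `<=` U n]].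

Definition J_gamma_Bs_cover (J : set (set nat)) BB : set (nat -> set X) :=
  [set U | [/\ is_cover (range U), forall n, open (U n)
             & forall B, BB B -> exists delta : nat -> R,
                 (forall n, 0 < delta n) /\
                 J [set n | ~ (enlarge B (delta n) `<=` U n)]]].

End Covers.

(* Main.v *)
Require Import Defs.
From mathcomp Require Import all_boot all_order all_algebra.
From mathcomp Require Import all_classical all_reals all_analysis.

(** A [gamma]-cover is a [J-gamma]-cover because [J] contains the finite sets,
    so one implication only weakens the conclusion of the selection principle.

    For the converse, let [A] be a pseudounion of [J] and let [k] be an
    injection of the natural numbers into the infinite set [~` A].  Every
    member of [J] meets [~` A] in a finite set, so its preimage under [k] is
    finite: along [k], a [J-gamma]-cover becomes a [gamma]-cover
    ([J_gamma_Bs_cover_comp]).  Given covers [u 0], [u 1], ... one therefore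
    applies the weak selection principle to a sequence whose term of index
    [k i] is [u i], and keeps only the sets selected at the indices [k i].

    The range of the selection thus obtained has to be infinite.  This is
    automatic ([infinite_range_eventually_covering]): a set selected
    infinitely often would contain every point, hence be the whole space,
    which no cover contains. *)

Local Open Scope classical_set_scope.
Local Open Scope ring_scope.

Lemma infinite_set_retract (C : set nat) : infinite_set C ->
  exists k f : nat -> nat, cancel k f /\ forall i, C (k i).
Proof.
move=> /infiniteP /pcard_leP /injfunPex [k kC k_inj].
exists k, (fun m => xget 0%N [set i | k i = m]); split=> [i|i]; last exact: kC.
case: xgetP => [j _ kji|/(_ i)/=]; last by [].
by apply: k_inj => //; rewrite in_setT.
Qed.

Lemma finite_set_nat_bounded (F : set nat) : finite_set F ->
  exists n0, forall n, (n0 <= n)%N -> ~ F n.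
Proof.
move=> /finite_seqP [s ->]; exists (\max_(i <- s) i).+1 => n ltsn /= sn.
by have := ltsn; rewrite ltnNge (@leq_bigmax_seq _ s xpredT (fun i => i) n).
Qed.

(** The fibre of [a] over [a m] is bounded, since a point missing from [a m]
    lies in all later [a n]; finitely many such fibres cannot exhaust the
    natural numbers. *)
Lemma infinite_range_eventually_covering (T : Type) (a : nat -> set T) :
  (forall n, a n <> [set: T]) ->
  (forall x, exists n0, forall n, (n0 <= n)%N -> a n x) ->
  infinite_set (range a).
Proof.
move=> a_proper a_cov fin_range; apply: infinite_nat.
apply: (@sub_finite_set _ _ (\bigcup_(V in range a) (a @^-1` [set V]))).
  by move=> n _; exists (a n) => //; exists n.
apply: bigcup_finite => // _ [m _ <-].
have [x amx] : exists x, ~ a m x.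
  apply/existsNP => amT; apply: (a_proper m).
  by apply/seteqP; split=> x _ //; exact: amT.
have [n0 an0] := a_cov x.
apply: (sub_finite_set _ (finite_II n0)) => n /= anm.
by rewrite ltnNge; apply/negP => /an0; rewrite anm.
Qed.

Section Covers.
Context {R : realType} {X : metricType R}.
Implicit Types (BB : set (set X)) (B : set X) (a : nat -> set X).

Lemma sub_enlarge B (delta : R) : 0 < delta -> B `<=` enlarge B delta.
Proof. by move=> delta_gt0 x Bx; exists x => //=; rewrite mdistxx. Qed.

Lemma bornology_set1 BB (x : X) : bornology BB -> BB [set x].
Proof.
move=> [BB_sub _ BB_cov]; have : [set: X] x by [].
by rewrite -BB_cov => -[B BB_B Bx]; apply: BB_sub BB_B => _ ->.
Qed.

Lemma gamma_J_gamma_Bs_cover (J : set (set nat)) BB a :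
  omega_ideal J -> gamma_Bs_cover BB a -> J_gamma_Bs_cover J BB a.
Proof.
move=> [_ _ J_fin _] [a_cov a_open _ a_gamma]; split=> // B /a_gamma.
move=> [n0 [delta a_delta]].
(* Below [n0] nothing is known about [delta], so 1 replaces it there. *)
exists (fun n => if (n0 <= n)%N then delta n else 1); split=> [n|].
  by case: ifP => // /a_delta [].
apply: J_fin; apply: (sub_finite_set _ (finite_II n0)) => n /= nB.
by rewrite ltnNge; apply/negP => n0n; apply: nB; rewrite n0n; case: (a_delta n n0n).
Qed.

(** For [I] in [J], the set [I `\` A] is finite and [k] hits each of its points
    at most once, so only finitely many indices of [a \o k] are exceptional. *)
Lemma J_gamma_Bs_cover_comp (J : set (set nat)) BB (A : set nat)
    (k : nat -> nat) a :
  bornology BB -> pseudounion J A -> injective k -> (forall i, ~ A (k i)) ->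
  J_gamma_Bs_cover J BB a -> gamma_Bs_cover BB (a \o k).
Proof.
move=> BB_born [_ JA] k_inj kA [[_ a_proper] a_open a_gamma].
have ak_gamma B : BB B -> exists (n0 : nat) (delta : nat -> R),
    forall n, (n0 <= n)%N ->
      0 < delta n /\ enlarge B (delta n) `<=` (a \o k) n.
  move=> /a_gamma [delta [delta_gt0 /JA fin_bad]].
  have /finite_set_nat_bounded [n0 n0P] :=
    finite_preimage (fun _ _ _ _ eqk => k_inj _ _ eqk) fin_bad.
  exists n0, (delta \o k) => n /n0P n_good; split; first exact: delta_gt0.
  by apply: contrapT => n_bad; apply: n_good; split.
have ak_cov x : exists n0, forall n, (n0 <= n)%N -> (a \o k) n x.
  have [n0 [delta n0P]] := ak_gamma _ (bornology_set1 _ x BB_born).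
  by exists n0 => n /n0P [delta_gt0]; apply; exact: sub_enlarge.
split=> // [|n|]; last 2 first.
- exact: a_open.
- apply: infinite_range_eventually_covering => // n akT.
  by apply: a_proper; exists (k n).
split=> [|[n _ akT]]; last by apply: a_proper; exists (k n).
apply/seteqP; split=> x _ //; have [n0 /(_ n0 (leqnn n0)) ak_x] := ak_cov x.
by exists ((a \o k) n0) => //; exists n0.
Qed.

End Covers.

Theorem theorem3p12 (R : realType) (X : metricType R)
    (X_infinite : infinite_set [set: X])
    (BB : set (set X)) (BB_bornology : bornology BB)
    (BB_closed_base : exists B0 : set (set X), closed_base BB B0)
    (X_Lindelof : Bs_Lindelof BB)
    (J : set (set nat)) (J_ideal : omega_ideal J)
    (J_pseudounion : exists A : set nat, pseudounion J A) :
  S1 (open_Bs_cover BB) (J_gamma_Bs_cover J BB) <->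
  S1 (open_Bs_cover BB) (gamma_Bs_cover BB).
Proof.
split=> [S1J u u_cov|S1g u /S1g [a [ua a_gamma]]]; last first.
  by exists a; split=> //; exact: gamma_J_gamma_Bs_cover.
have [A psA] := J_pseudounion.
have [k [f [kK kA]]] := infinite_set_retract _ psA.1.
(* The term of index [k i] of [u \o f] is [u i]. *)
have [a [ua a_gamma]] := S1J (u \o f) (fun n => u_cov (f n)).
exists (a \o k); split=> [n|]; first by have := ua (k n); rewrite /= kK.
exact: J_gamma_Bs_cover_comp _ _ _ _ _ BB_bornology psA (can_inj kK) kA a_gamma.
Qed.
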